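(* Let $S(x)=\sum_{n\ge 4}s_nx^n$, where $s_n$ is the number of simple permutations in $\mathcal{S}_n$, and let $W(x)=\sum_{n\ge1}w_nx^n$, where $w_n$ is the number of block-wise simple permutations in $\mathcal{S}_n$. Let $W^{-1}$ be the compositional inverse of $W$ as a formal power series. Then, as formal power series, $$S(t)=t-W^{-1}(t).$$
   Context: $\mathcal{S}_n$ is the set of permutations of $\{1,\dots,n\}$, written in one-line notation. An interval of $\pi=a_1\cdots a_n\in\mathcal{S}_n$ is a non-empty contiguous sequence of entries $a_ia_{i+1}\cdots a_{i+k}$ whose values form a set of consecutive integers. The whole permutation and the single entries are the trivial intervals; all others are proper. A permutation is simple if it has no proper intervals (only simple permutations of order at least $4$ are counted in $S$). Inflation: for $\sigma\in\mathcal{S}_k$ and $\alpha_i\in\mathcal{S}_{n_i}$ ($n_i\ge1$, $1\le i\le k$), $\sigma[\alpha_1,\dots,\alpha_k]\in\mathcal{S}_{n_1+\cdots+n_k}$ is the permutation obtained by replacing the $i$-th entry of $\sigma$, for each $i$, by a block of $n_i$ consecutive positions and consecutive values that is order-isomorphic to $\alpha_i$, the blocks being in the same relative order (in values) as the entries of $\sigma$. Example: $2413[213,21,132,1]=546\,98\,132\,7$. Block-wise simple permutations are defined recursively: (1) the permutation $1\in\mathcal{S}_1$ is block-wise simple; (2) $\pi\in\mathcal{S}_n$ is block-wise simple if there are a simple permutation $\sigma\in\mathcal{S}_k$ with $k\ge 4$ and block-wise simple permutations $\alpha_1,\dots,\alpha_k$ such that $\pi=\sigma[\alpha_1,\dots,\alpha_k]$.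 No other permutations are block-wise simple (so $w_1=1$, $w_2=w_3=0$). *)

(* Defs.v *)
From mathcomp Require Import all_boot all_order all_fingroup all_algebra.
From mathcomp Require Import boolp.

Set Implicit Arguments.
Unset Strict Implicit.
Unset Printing Implicit Defensive.

Import GRing.Theory.
Local Open Scope ring_scope.

(* Positions and values of a permutation of order n both range over
   'I_n = {0, ..., n - 1} instead of {1, ..., n}. *)

Definition consecutive (n : nat) (A : {set 'I_n}) : bool :=
  [exists a : 'I_n, exists b : 'I_n,
    (a <= b)%N && (A == [set x : 'I_n | (a <= x <= b)%N])].

(* An interval is given by its set of positions A; the values it contains
   form the set s @: A. *)
Definition interval (n : nat) (s : 'S_n) (A : {set 'I_n}) : bool :=
  consecutive A && consecutive (s @: A).

Definition trivial_interval (n : nat) (A : {set 'I_n}) : bool :=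
  (#|A| == 1)%N || (A == [set: 'I_n]).

Definition simple_perm (n : nat) (s : 'S_n) : bool :=
  [forall A : {set 'I_n}, interval s A ==> trivial_interval A].

(* is_inflation s a p means p = s[a_1, ..., a_k].  The i-th block occupies the
   positions following the blocks j < i, and the values above those of the
   blocks j with s j < s i; inside the block, p is a copy of a i. *)
Definition is_inflation (k : nat) (s : 'S_k) (m : 'I_k -> nat)
    (a : forall i : 'I_k, 'S_(m i)) (n : nat) (p : 'S_n) : Prop :=
  n = (\sum_(i < k) m i)%N /\
  forall (i : 'I_k) (x : 'I_(m i)) (y : 'I_n),
    y = (\sum_(j < k | (j < i)%N) m j + x)%N :> nat ->
    p y = (\sum_(j < k | (s j < s i)%N) m j + a i x)%N :> nat.

(* The condition n_i >= 1 on the blocks need not be required separately: no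
   permutation of order 0 is block-wise simple. *)
Inductive blockwise_simple : forall n : nat, 'S_n -> Prop :=
| Blockwise_simple_one : blockwise_simple (1%g : 'S_1)
| Blockwise_simple_inflation (k : nat) (s : 'S_k) (m : 'I_k -> nat)
    (a : forall i : 'I_k, 'S_(m i)) (n : nat) (p : 'S_n) :
    (4 <= k)%N -> simple_perm s ->
    (forall i : 'I_k, blockwise_simple (a i)) ->
    is_inflation s a p -> blockwise_simple p.

(* A formal power series over R is its sequence of coefficients. *)
Definition fps (R : Type) : Type := nat -> R.

Section FormalPowerSeries.
Variable R : comNzRingType.
Implicit Types f g : fps R.

Definition fps_one : fps R := fun n => (n == 0)%N%:R.
Definition fps_X : fps R := fun n => (n == 1)%N%:R.
Definition fps_sub f g : fps R := fun n => f n - g n.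
Definition fps_mul f g : fps R := fun n => \sum_(i < n.+1) f i * g (n - i)%N.
Definition fps_exp f (k : nat) : fps R := iter k (fps_mul f) fps_one.

(* f(g(x)) = \sum_k f_k g(x)^k, for g with zero constant term: then g^k has no
   term of degree < k, so the coefficient of x^n only involves k <= n. *)
Definition fps_comp f g : fps R :=
  fun n => \sum_(k < n.+1) f k * fps_exp g k n.

Definition is_fps_comp_inverse f g : Prop :=
  [/\ f 0%N = 0, g 0%N = 0, fps_comp f g =1 fps_X & fps_comp g f =1 fps_X].

End FormalPowerSeries.

Arguments fps_one {R}.
Arguments fps_X {R}.

Definition simple_series : fps int := fun n =>
  if (4 <= n)%N then #|[set s : 'S_n | simple_perm s]|%:Z else 0.

Definition blockwise_simple_series : fps int := fun n =>
  if (1 <= n)%N then #|[set s : 'S_n | `[< blockwise_simple s >]]|%:Z else 0.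

(* Main.v *)
Require Import Defs.
From mathcomp Require Import all_boot all_order all_fingroup all_algebra.
From mathcomp Require Import boolp zify.

(* A block-wise simple permutation of order at least 2 is an inflation of a
   simple permutation by block-wise simple blocks in exactly one way: an
   interval other than the whole permutation lies inside a single block, so two
   such decompositions refine each other.  Counting the inflations gives
   W = X + S o W, that is (X - S) o W = X.  Since W has zero constant term and
   linear coefficient 1, a left compositional inverse of W is also a right
   inverse, and it is unique. *)

Set Implicit Arguments.
Unset Strict Implicit.
Unset Printing Implicit Defensive.

Import GRing.Theory.

(** * Existence of inflations *)

Section Blocks.
Variables (k : nat) (s : 'S_k) (m : 'I_k -> nat).
Implicit Types z : {i : 'I_k & 'I_(m i)}.

(** An entry has as coordinates its block and its offset there. For [s] this gives its value, for
    the identity its position, so the lemmas below serve both sides of an inflation. *)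
Definition block_place z : nat :=
  \sum_(j < k | s j < s (tag z)) m j + tagged z.

Lemma block_end_le (i i' : 'I_k) : s i < s i' ->
  \sum_(j < k | s j < s i) m j + m i <= \sum_(j < k | s j < s i') m j.
Proof.
move=> lt_ii'; rewrite [leqRHS](bigD1 i) //= addnC leq_add2l.
rewrite big_mkcond [leqRHS]big_mkcond /=; apply: leq_sum => j _.
case: ifP => // lt_ji; rewrite (ltn_trans lt_ji lt_ii') /=.
by case: eqP lt_ji => //= ->; rewrite ltnn.
Qed.

Lemma block_place_bound z : block_place z < \sum_(j < k) m j.
Proof.
rewrite /block_place [ltnRHS](bigD1 (tag z)) //= addnC -addSn leq_add //.
rewrite big_mkcond [leqRHS]big_mkcond /=; apply: leq_sum => j _.
by case: ifP => // lt_ji; case: eqP lt_ji => //= ->; rewrite ltnn.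
Qed.

Lemma block_place_lt z z' : s (tag z) < s (tag z') -> block_place z < block_place z'.
Proof.
move/block_end_le => le_zz'; apply: leq_trans (leq_addr _ _).
by apply: leq_trans le_zz'; rewrite ltn_add2l.
Qed.

Lemma block_place_inj : injective block_place.
Proof.
move=> z z' eq_zz'.
have [/block_place_lt | /block_place_lt | ] := ltngtP (s (tag z)) (s (tag z')).
- by rewrite eq_zz' ltnn.
- by rewrite eq_zz' ltnn.
move/val_inj/perm_inj; case: z z' eq_zz' => [i x] [i' x'] /= + eq_i.
rewrite -{i'}eq_i in x' *.
by rewrite /block_place /= => /addnI /val_inj ->.
Qed.

(** An injection between finite sets of the same size is onto: there are [\sum_(j < k) m j] pairs of
    block and offset. *)
Lemma block_place_onto n (y : 'I_n) : n = \sum_(j < k) m j ->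
  exists z, y = block_place z :> nat.
Proof.
move=> def_n.
have lt_n z : block_place z < n by rewrite def_n block_place_bound.
have inj : injective (fun z => Ordinal (lt_n z)).
  by move=> z z' [] /block_place_inj.
have le_card : #|'I_n| <= #|{: {i : 'I_k & 'I_(m i)}}|.
  rewrite card_tagged card_ord def_n sumnE big_map big_enum /=.
  by apply: leq_sum => i _; rewrite card_ord.
have /codomP[z ->] := inj_card_onto inj le_card y.
by exists z.
Qed.

End Blocks.

Lemma block_place1 k (m : 'I_k -> nat) (z : {i : 'I_k & 'I_(m i)}) :
  block_place 1 z = \sum_(j < k | j < tag z) m j + tagged z.
Proof. by congr (_ + _); apply: eq_bigl => j; rewrite !perm1. Qed.

Lemma is_inflationE k (s : 'S_k) (m : 'I_k -> nat) (a : forall i, 'S_(m i))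
    n (p : 'S_n) :
  is_inflation s a p <->
  n = \sum_(i < k) m i /\ forall (z : {i : 'I_k & 'I_(m i)}) (y : 'I_n),
    y = block_place 1 z :> nat ->
    p y = block_place s (Tagged (fun i => 'I_(m i)) (a (tag z) (tagged z))) :> nat.
Proof.
split=> -[def_n infl]; split=> //.
  by move=> z y; rewrite block_place1 => /infl.
move=> i x y def_y; apply: (infl (Tagged (fun i => 'I_(m i)) x)).
by rewrite block_place1.
Qed.

(** Read the coordinates of a position, permute the offset by the block's own permutation, and read
    the result as a value. Each stage is injective, hence so is the composite. *)
Lemma inflation_exists k (s : 'S_k) (m : 'I_k -> nat) (a : forall i, 'S_(m i)) n :
  n = \sum_(i < k) m i -> exists p : 'S_n, is_inflation s a p.
Proof.
move=> def_n; pose I_ i := 'I_(m i).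
have [g def_g] := choice (fun y : 'I_n => block_place_onto 1 y def_n).
have g_inj : injective g by move=> y y' eq_g; apply: val_inj; rewrite /= !def_g eq_g.
pose act (z : {i : 'I_k & 'I_(m i)}) := Tagged I_ (a (tag z) (tagged z)).
have lt_n y : block_place s (act (g y)) < n by rewrite def_n block_place_bound.
have f_inj : injective (fun y => Ordinal (lt_n y)).
  move=> y y' [] /block_place_inj; rewrite /act.
  case: (g y) (g y') (@g_inj y y') => [i x] [i' x'] /= eqg eqa.
  apply: eqg; have /= eq_i := congr1 tag eqa; rewrite -{i'}eq_i in x' eqa *.
  by have /= := eq_from_Tagged eqa => /perm_inj ->.
exists (perm f_inj); apply/is_inflationE; split=> // z y; rewrite permE /= def_g.
by move/block_place_inj <-.
Qed.

Lemma inflation_perm_unique k (s : 'S_k) (m : 'I_k -> nat)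
    (a : forall i, 'S_(m i)) n (p q : 'S_n) :
  is_inflation s a p -> is_inflation s a q -> p = q.
Proof.
move=> /is_inflationE[def_n p_s] /is_inflationE[_ q_s].
apply/permP=> y; have [z def_y] := block_place_onto 1 y def_n.
by apply: val_inj; rewrite /= (p_s _ _ def_y) (q_s _ _ def_y).
Qed.

Lemma inflation_blocks_unique k (s : 'S_k) (m : 'I_k -> nat)
    (a a' : forall i, 'S_(m i)) n (p : 'S_n) :
  is_inflation s a p -> is_inflation s a' p -> forall i, a i = a' i.
Proof.
move=> /is_inflationE[def_n p_a] /is_inflationE[_ p_a'] i; apply/permP=> x.
pose z := Tagged (fun i => 'I_(m i)) x.
have lt_n : block_place 1 z < n by rewrite def_n block_place_bound.
have := p_a z (Ordinal lt_n) erefl; rewrite (p_a' z) //.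
by move/addnI/val_inj.
Qed.

(** * Uniqueness of the simple quotient *)

(** Form of [consecutive] without endpoints, which passes easily through monotone maps; the empty
    set satisfies it too. *)
Definition convex n (A : {set 'I_n}) : Prop :=
  forall x y z : 'I_n, x \in A -> z \in A -> x < y < z -> y \in A.

Lemma consecutive_convex n (A : {set 'I_n}) :
  A != set0 -> convex A -> consecutive A.
Proof.
case/set0Pn=> x0 x0A A_cvx.
case: (arg_minnP (fun x : 'I_n => x : nat) x0A) => a aA a_min.
case: (arg_maxnP (fun x : 'I_n => x : nat) x0A) => b bA b_max.
apply/existsP; exists a; apply/existsP; exists b.
rewrite a_min //; apply/eqP/setP=> x; rewrite inE.
apply/idP/andP=> [xA | [le_ax le_xb]]; first by split; [apply: a_min | apply: b_max].
have [/val_inj <- // | neq_ax] := eqVneq (a : nat) x.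
have [/val_inj -> // | neq_xb] := eqVneq (x : nat) b.
by apply: A_cvx aA bA _; lia.
Qed.

Lemma convex_setC1 k (i : 'I_k) :
  (i == 0 :> nat) || (i == k.-1 :> nat) -> convex [set~ i].
Proof.
move=> ext_i x y z; rewrite !inE => neq_x neq_z lt_xyz; apply/eqP => def_y.
by have := ltn_ord z; have := ltn_ord x; subst y; lia.
Qed.

(** Deleting an entry extremal in both position and value would leave [k - 1 >= 2] entries forming a
    proper interval. *)
Lemma simple_perm_corner k (s : 'S_k) (i : 'I_k) : 3 <= k -> simple_perm s ->
  (i == 0 :> nat) || (i == k.-1 :> nat) ->
  ~~ ((s i == 0 :> nat) || (s i == k.-1 :> nat)).
Proof.
move=> k_ge3 /forallP simple_s ext_i; apply/negP=> ext_si.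
have card_C j : #|[set~ j : 'I_k]| = k.-1 by rewrite cardsC1 card_ord.
have C_n0 (j : 'I_k) : [set~ j] != set0 by rewrite -card_gt0 card_C; lia.
(* Unqualified, [interval] is the MathComp type of intervals of an ordered type. *)
have: Defs.interval s [set~ i].
  have -> : Defs.interval s [set~ i] = consecutive [set~ i] && consecutive [set~ s i].
    congr (_ && consecutive _); apply/setP=> j; rewrite !inE.
    apply/imsetP/idP=> [[l] | neq_j].
      by rewrite !inE => neq_l ->; rewrite (inj_eq perm_inj).
    by exists (s^-1 j)%g; rewrite ?permKV // !inE -(inj_eq (@perm_inj _ s)) permKV.
  by rewrite !consecutive_convex //; apply: convex_setC1.
move/(implyP (simple_s _)); rewrite /trivial_interval card_C.
case/orP=> [|/eqP/setP/(_ i)]; last by rewrite !inE eqxx.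
lia.
Qed.

(** A weakly increasing surjection, with monotonicity in contrapositive form; its fibres cut ['I_n]
    into [k] consecutive blocks. *)
Definition block_map n k (b : 'I_n -> 'I_k) : Prop :=
  (forall i, exists x, b x = i) /\ (forall x y, b x < b y -> x < y).

Lemma block_map_convex n k (b : 'I_n -> 'I_k) (A : {set 'I_n}) :
  block_map b -> convex A -> convex (b @: A).
Proof.
move=> [b_onto b_mono] A_cvx _ i _ /imsetP[x xA ->] /imsetP[z zA ->].
have [y <-] := b_onto i => /andP[lt_xy lt_yz]; apply: imset_f.
by apply: A_cvx xA zA _; rewrite !b_mono.
Qed.

Lemma block_map_fiber_convex n k (b : 'I_n -> 'I_k) (i : 'I_k) :
  block_map b -> convex [set x | b x == i].
Proof.
move=> [_ b_mono] x y z; rewrite !inE => /eqP bx /eqP bz /andP[lt_xy lt_yz].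
apply/eqP/val_inj/eqP; rewrite /= eqn_leq -{1}bz -bx.
by apply/andP; split; rewrite leqNgt; apply/negP => /b_mono; lia.
Qed.

(** [A] meets the first and the last block, so a point in any other block lies between two elements
    of [A]. *)
Lemma block_map_outside n k (b : 'I_n -> 'I_k) (A : {set 'I_n}) x :
  block_map b -> convex A -> b @: A = setT -> x \notin A ->
  (b x == 0 :> nat) || (b x == k.-1 :> nat).
Proof.
move=> [_ b_mono] A_cvx bA xA; apply: contraR xA; rewrite negb_or => /andP[bx0 bx1].
have lt_bx := ltn_ord (b x).
have k_gt0 : 0 < k by lia.
have k_gt1 : k.-1 < k by lia.
have /imsetP[y yA def_y] : Ordinal k_gt0 \in b @: A by rewrite bA inE.
have /imsetP[z zA def_z] : Ordinal k_gt1 \in b @: A by rewrite bA inE.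
by apply: A_cvx yA zA _; rewrite !b_mono // -?def_y -?def_z /=; lia.
Qed.

Section Factor.
Variables (n k : nat) (p : 'S_n) (s : 'S_k) (b : 'I_n -> 'I_k).

(* p is an inflation of s whose blocks are the fibres of b. *)
Definition block_factor : Prop :=
  block_map b /\ block_map (fun v => s (b (p^-1 v)%g)).

Hypotheses (k_ge3 : 3 <= k) (simple_s : simple_perm s) (b_factor : block_factor).

(** The blocks met by an interval form an interval of [s], so by simplicity [A] meets either a
    single block or all of them. *)
Lemma proper_interval_sub_block (A : {set 'I_n}) x y :
    convex A -> convex (p @: A) -> A != setT ->
  x \in A -> y \in A -> b x = b y.
Proof.
case: b_factor => b_map c_map A_cvx pA_cvx A_proper xA yA.
have A_n0 : A != set0 by apply/set0Pn; exists x.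
(* Seen from the values, the blocks met by [A] are the image of [p @: A] under the second block map,
   which yields convexity on the value side. *)
have imE : s @: (b @: A) = (fun v => s (b (p^-1 v)%g)) @: (p @: A).
  by rewrite -!imset_comp; apply: eq_imset => t /=; rewrite permK.
have n0 (T : finType) (f : 'I_n -> T) : f @: A != set0.
  by apply/set0Pn; exists (f x); apply: imset_f.
have pA_n0 : p @: A != set0 by apply/set0Pn; exists (p x); apply: imset_f.
have bA_int : Defs.interval s (b @: A).
  rewrite /Defs.interval !consecutive_convex ?n0 //; last exact: block_map_convex.
    by rewrite -imset_comp n0.
  by rewrite imE; apply: block_map_convex.
have /orP[/cards1P[i bA] | /eqP bA] := implyP (forallP simple_s _) bA_int.
  have: b x \in b @: A by apply: imset_f.
  have: b y \in b @: A by apply: imset_f.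
  by rewrite bA !inE => /eqP-> /eqP->.
(* If A met every block, a position t outside A would lie in a block extremal
   both in position and in value, and the other entries of s would form a
   proper interval. *)
have [t _ tA] : exists2 t, t \in [set: 'I_n] & t \notin A.
  by apply/subsetPn; rewrite subTset.
have bt := block_map_outside b_map A_cvx bA tA.
have sT : s @: setT = setT.
  by apply/setP=> j; rewrite !inE; apply/imsetP; exists (s^-1 j)%g; rewrite ?permKV.
have ptA : p t \notin p @: A by rewrite mem_imset //; apply: perm_inj.
rewrite bA sT in imE.
have := block_map_outside c_map pA_cvx (esym imE) ptA; rewrite /= permK.
by rewrite (negbTE (simple_perm_corner k_ge3 simple_s bt)).
Qed.

End Factor.

(** Each fibre of [b'] is an interval of [p], and not the whole of it because [k' > 1]; hence it
    lies inside one block of [b]. *)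
Lemma block_factor_refine n (p : 'S_n) k k' (s : 'S_k) (s' : 'S_k') b b' :
    3 <= k -> simple_perm s -> block_factor p s b ->
    1 < k' -> block_factor p s' b' ->
  forall x y, b' x = b' y -> b x = b y.
Proof.
move=> k_ge3 simple_s fac k'_gt1 [b'_map c'_map] x y eq_b'.
apply: (proper_interval_sub_block k_ge3 simple_s fac (A := [set z | b' z == b' y])).
- exact: block_map_fiber_convex.
- have -> : p @: [set z | b' z == b' y] = [set v | s' (b' (p^-1 v)%g) == s' (b' y)].
    apply/setP=> v; rewrite inE (inj_eq perm_inj) -{1}(permKV p v).
    by rewrite mem_imset ?inE //; apply: perm_inj.
  exact: block_map_fiber_convex.
- apply/eqP=> /setP all_y; have [b'_onto _] := b'_map.
  have [z0 b'z0] := b'_onto (Ordinal (ltnW k'_gt1)).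
  have [z1 b'z1] := b'_onto (Ordinal k'_gt1).
  have := all_y z0; have := all_y z1; rewrite !inE b'z0 b'z1 => /eqP<- /eqP.
  by case.
- by rewrite inE eq_b'.
by rewrite inE.
Qed.

(** Induction on [b x]: some [y] lies in the block just before that of [x]. Then [y < x], and [b']
    must separate [y] from [x] since [b] does, so [b'] also increases from [y] to [x]. *)
Lemma block_map_le n k k' (b : 'I_n -> 'I_k) (b' : 'I_n -> 'I_k') :
    block_map b -> block_map b' -> (forall x y, b' x = b' y -> b x = b y) ->
  forall x, b x <= b' x.
Proof.
move=> [b_onto b_mono] [_ b'_mono] ker x; move Di: (b x : nat) => i.
elim: i x Di => // i IHi x Di.
have lt_i : i < k by have := ltn_ord (b x); lia.
have [y by_i] := b_onto (Ordinal lt_i); have Dy : b y = i :> nat by rewrite by_i.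
have lt_yx : y < x by apply: b_mono; rewrite Dy Di.
apply: leq_ltn_trans (IHi y Dy) _; rewrite ltnNge leq_eqVlt.
apply/negP=> /orP[/eqP/val_inj/ker eq_b | /b'_mono]; last lia.
by move: Dy; rewrite -eq_b Di; lia.
Qed.

Lemma block_map_order_le n k k' (b : 'I_n -> 'I_k) (b' : 'I_n -> 'I_k') :
    block_map b -> (forall x, b x <= b' x) -> k <= k'.
Proof.
case: k b => // k b [b_onto _] le_bb'; have [x bx] := b_onto ord_max.
by apply: leq_ltn_trans (ltn_ord (b' x)); apply: leq_trans (le_bb' x); rewrite bx.
Qed.

(* The Albert-Atkinson uniqueness theorem for the substitution decomposition. *)
Lemma block_factor_unique n (p : 'S_n) k k' (s : 'S_k) (s' : 'S_k') b b' :
    3 <= k -> simple_perm s -> block_factor p s b ->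
    3 <= k' -> simple_perm s' -> block_factor p s' b' ->
  [/\ k = k', forall x, b x = b' x :> nat &
      forall x, s (b x) = s' (b' x) :> nat].
Proof.
move=> k_ge3 simple_s fac k'_ge3 simple_s' fac'.
have ker := block_factor_refine k_ge3 simple_s fac (ltnW k'_ge3) fac'.
have ker' := block_factor_refine k'_ge3 simple_s' fac' (ltnW k_ge3) fac.
have [[b_map c_map] [b'_map c'_map]] := (fac, fac').
have le_bb' := block_map_le b_map b'_map ker.
have le_b'b := block_map_le b'_map b_map ker'.
split=> [|x|x].
- by apply/eqP; rewrite eqn_leq (block_map_order_le b_map le_bb')
    (block_map_order_le b'_map le_b'b).
- by apply/eqP; rewrite eqn_leq le_bb' le_b'b.
(* Writing [x] as the preimage of [p x] exposes the block maps on values, to which the same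
   comparison applies. *)
rewrite -[x](permK p); apply/eqP; rewrite eqn_leq.
rewrite (block_map_le c_map c'_map) ?(block_map_le c'_map c_map) //=.
  by move=> u v /perm_inj/ker' ->.
by move=> u v /perm_inj/ker ->.
Qed.

(** The block map takes the [tag] of the coordinates of a position; positive block sizes make it
    onto, and [block_place_lt] gives monotonicity for positions and for values. *)
Lemma inflation_block_factor k (s : 'S_k) (m : 'I_k -> nat)
    (a : forall i, 'S_(m i)) n (p : 'S_n) :
  (forall i, 0 < m i) -> is_inflation s a p ->
  exists2 b, block_factor p s b & forall i, m i = #|[set x | b x == i]|.
Proof.
move=> m_gt0 /is_inflationE[def_n infl].
have [g def_g] := choice (fun y : 'I_n => block_place_onto 1 y def_n).
have lt_n (z : {i : 'I_k & 'I_(m i)}) : block_place 1 z < n.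
  by rewrite def_n block_place_bound.
have gK z : g (Ordinal (lt_n z)) = z.
  by apply: (@block_place_inj _ 1); rewrite -def_g.
pose I_ i := 'I_(m i).
have b_onto i : exists x, tag (g x) = i.
  by exists (Ordinal (lt_n (Tagged I_ (Ordinal (m_gt0 i))))); rewrite gK.
exists (fun y => tag (g y)).
  split; split.
  - exact: b_onto.
  - by move=> x y; rewrite !def_g => lt_xy; apply: block_place_lt; rewrite !perm1.
  - move=> i; have [x def_x] := b_onto (s^-1 i)%g; exists (p x).
    by rewrite permK def_x permKV.
  - move=> u v lt_uv; rewrite -[u](permKV p) -[v](permKV p) !(infl _ _ (def_g _)).
    exact: block_place_lt.
move=> i; rewrite -[LHS]card_ord.
have inj : injective (fun x : 'I_(m i) => Ordinal (lt_n (Tagged I_ x))).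
  by move=> x y []; rewrite /block_place /= => /addnI/val_inj.
rewrite -(card_imset _ inj); congr #|pred_of_set _|; apply/setP=> y; rewrite inE.
apply/imsetP/eqP=> [[x _ ->] | <-]; first by rewrite gK.
by exists (tagged (g y)) => //; apply: val_inj; rewrite /= def_g; case: (g y).
Qed.

(** Equality of the orders comes first, since [s] and [s'] can be compared only within one type. *)
Lemma inflation_order_unique k k' (s : 'S_k) (s' : 'S_k') m m'
    (a : forall i : 'I_k, 'S_(m i)) (a' : forall i : 'I_k', 'S_(m' i)) n (p : 'S_n) :
    3 <= k -> simple_perm s -> (forall i, 0 < m i) -> is_inflation s a p ->
    3 <= k' -> simple_perm s' -> (forall i, 0 < m' i) -> is_inflation s' a' p ->
  k = k'.
Proof.
move=> k_ge3 simple_s m_gt0 /(inflation_block_factor m_gt0)[b fac _].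
move=> k'_ge3 simple_s' m'_gt0 /(inflation_block_factor m'_gt0)[b' fac' _].
by have [] := block_factor_unique k_ge3 simple_s fac k'_ge3 simple_s' fac'.
Qed.

Lemma inflation_shape_unique k (s s' : 'S_k) m m'
    (a : forall i : 'I_k, 'S_(m i)) (a' : forall i : 'I_k, 'S_(m' i)) n (p : 'S_n) :
    3 <= k -> simple_perm s -> (forall i, 0 < m i) -> is_inflation s a p ->
    simple_perm s' -> (forall i, 0 < m' i) -> is_inflation s' a' p ->
  s = s' /\ m =1 m'.
Proof.
move=> k_ge3 simple_s m_gt0 /(inflation_block_factor m_gt0)[b fac mE].
move=> simple_s' m'_gt0 /(inflation_block_factor m'_gt0)[b' fac' m'E].
have [_ eq_b eq_sb] := block_factor_unique k_ge3 simple_s fac k_ge3 simple_s' fac'.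
split=> [|i].
  apply/permP=> i; have [[b_onto _] _] := fac; have [x <-] := b_onto i.
  by apply: val_inj; rewrite /= eq_sb; congr (s' _ : nat); apply/val_inj/esym/eq_b.
by rewrite mE m'E; apply: eq_card => x; rewrite !inE (val_inj (eq_b x)).
Qed.

(** * Composition of formal power series *)

Local Open Scope ring_scope.

Section Series.
Variable R : comNzRingType.
Implicit Types (f g h : fps R) (p q r : {poly R}).

Lemma coef_exp_lt r n i : r`_0 = 0 -> (n < i)%N -> (r ^+ i)`_n = 0.
Proof.
move=> r0; elim: i n => // i IHi n lt_ni; rewrite exprS coefM big1 // => j _.
have [-> | j_gt0] := posnP j; first by rewrite r0 mul0r.
by rewrite IHi ?mulr0 //; have := ltn_ord j; lia.
Qed.

Lemma coef_exp_diag r n : r`_0 = 0 -> (r ^+ n)`_n = r`_1 ^+ n.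
Proof.
move=> r0; elim: n => [|n IHn]; first by rewrite !expr0 coef1.
rewrite !exprS coefM 2!big_ord_recl /= r0 mul0r add0r /bump /= subn1 /= IHn.
rewrite big1 ?addr0 // => j _; rewrite coef_exp_lt ?mulr0 //.
by have := ltn_ord j; rewrite /bump /=; lia.
Qed.

(** Polynomial composition sums up to [size p], series composition up to [n]. Both sums extend to
    the larger bound: the extra terms vanish through [p] in one case and through the powers of [r]
    in the other. *)
Lemma coef_comp_poly0 p r n : r`_0 = 0 ->
  (p \Po r)`_n = \sum_(i < n.+1) p`_i * (r ^+ i)`_n.
Proof.
move=> r0; rewrite comp_polyE coef_sum.
under eq_bigr do rewrite coefZ.
pose F i := p`_i * (r ^+ i)`_n.
have ext a b : (a <= b)%N -> (forall i, (a <= i)%N -> F i = 0) ->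
  \sum_(i < a) F i = \sum_(i < b) F i.
  move=> le_ab F0; rewrite -!(big_mkord xpredT) /=.
  rewrite [RHS](big_cat_nat (leq0n a) le_ab) /=.
  rewrite [X in _ + X]big_nat_cond [X in _ + X]big1 ?addr0 // => i.
  by rewrite andbT => /andP[/F0].
transitivity (\sum_(i < maxn (size p) n.+1) F i).
  by apply: ext => [|i le_i]; rewrite ?leq_maxl // /F nth_default ?mul0r.
apply/esym/ext => [|i le_i]; rewrite ?leq_maxr //.
by rewrite /F coef_exp_lt ?mulr0.
Qed.

(** Degree [n] is kept, so coefficients up to [n] of powers and compositions can be computed with
    polynomials. *)
Definition fps_trunc n f : {poly R} := \poly_(i < n.+1) f i.

Lemma coef_trunc n f i : (i <= n)%N -> (fps_trunc n f)`_i = f i.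
Proof. by move=> le_in; rewrite coef_poly ltnS le_in. Qed.

Lemma coef_exp_eq p q N k : (forall i, (i <= N)%N -> p`_i = q`_i) ->
  forall n, (n <= N)%N -> (p ^+ k)`_n = (q ^+ k)`_n.
Proof.
move=> eq_pq; elim: k => [|k IHk] n le_nN; first by rewrite !expr0.
rewrite !exprS !coefM; apply: eq_bigr => i _.
by rewrite eq_pq ?IHk //; have := ltn_ord i; lia.
Qed.

Lemma fps_exp_trunc N f k n : (n <= N)%N ->
  fps_exp f k n = (fps_trunc N f ^+ k)`_n.
Proof.
elim: k n => [|k IHk] n le_nN; first by rewrite expr0 coef1.
rewrite exprS coefM -[fps_exp f _]/(fps_mul f (fps_exp f k)).
apply: eq_bigr => i _.
by rewrite coef_trunc ?IHk //; have := ltn_ord i; lia.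
Qed.

Lemma fps_comp_trunc N f g n : g 0%N = 0 -> (n <= N)%N ->
  fps_comp f g n = (fps_trunc N f \Po fps_trunc N g)`_n.
Proof.
move=> g0 le_nN; rewrite coef_comp_poly0 ?coef_trunc //; apply: eq_bigr => i _.
by rewrite (fps_exp_trunc _ _ le_nN) coef_trunc //; have := ltn_ord i; lia.
Qed.

Lemma fps_comp0 f g : f 0%N = 0 -> fps_comp f g 0%N = 0.
Proof. by move=> f0; rewrite /fps_comp big_ord1 f0 mul0r. Qed.

Lemma fps_compA f g h : g 0%N = 0 -> h 0%N = 0 ->
  fps_comp (fps_comp f g) h =1 fps_comp f (fps_comp g h).
Proof.
move=> g0 h0 n; pose T := fps_trunc n.
have T0 u : u 0%N = 0 -> (T u)`_0 = 0 by rewrite coef_trunc.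
have gh0 := fps_comp0 h g0.
transitivity ((T f \Po T g \Po T h)`_n).
  rewrite (@fps_comp_trunc n) // !coef_comp_poly0 ?T0 //; apply: eq_bigr => i _.
  have le_in : (i <= n)%N by rewrite -ltnS.
  by rewrite coef_trunc // (fps_comp_trunc _ g0 le_in).
have TT0 : (T g \Po T h)`_0 = 0 by rewrite -fps_comp_trunc.
rewrite -comp_polyA (@fps_comp_trunc n) //.
rewrite (coef_comp_poly0 _ _ TT0) coef_comp_poly0 ?T0 //.
apply: eq_bigr => i _; congr (_ * _); apply: (@coef_exp_eq _ _ n) => // j le_jn.
by rewrite coef_trunc // (fps_comp_trunc _ h0 le_jn).
Qed.

(** Composition with [h] is unitriangular on coefficients, as [h^n] begins with [x^n]; strong
    induction recovers each coefficient. *)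
Lemma fps_comp_inj f g h : h 0%N = 0 -> h 1%N = 1 ->
  fps_comp f h =1 fps_comp g h -> f =1 g.
Proof.
move=> h0 h1 eq_fg n; elim/ltn_ind: n => n IHn; have := eq_fg n.
have diag : fps_exp h n n = 1.
  case: n {IHn} => [|n]; first by [].
  by rewrite (@fps_exp_trunc n.+1) // coef_exp_diag !coef_trunc // h1 expr1n.
rewrite /fps_comp !big_ord_recr /= diag !mulr1.
by under eq_bigr => i _ do rewrite IHn //; move/addrI.
Qed.

Lemma fps_comp_X f : f 0%N = 0 -> fps_comp fps_X f =1 f.
Proof.
move=> f0 [|n]; first by rewrite fps_comp0.
rewrite (@fps_comp_trunc n.+1) //.
suff -> : fps_trunc n.+1 fps_X = 'X by rewrite comp_polyX coef_trunc.
by apply/polyP=> i; rewrite coef_poly coefX /fps_X; case: i => [|[|i]] //=; case: ifP.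
Qed.

Lemma fps_comp_Xr f : fps_comp f fps_X =1 f.
Proof.
move=> n; rewrite (@fps_comp_trunc n) //.
case: n => [|n].
  by rewrite coef_comp_poly0 ?big_ord1 ?coef_trunc // expr0 coef1 mulr1.
suff -> : fps_trunc n.+1 fps_X = 'X by rewrite comp_polyXr coef_trunc.
by apply/polyP=> i; rewrite coef_poly coefX /fps_X; case: i => [|[|i]] //=; case: ifP.
Qed.

(** Expanding the [k]-th power of the truncation by distributivity selects a degree [m i] in each
    factor. *)
Lemma fps_exp_sum_comp f k n :
  fps_exp f k n =
  \sum_(m : {ffun 'I_k -> 'I_n.+1} | (\sum_i m i == n)%N) \prod_i f (m i).
Proof.
rewrite (@fps_exp_trunc n) // /fps_trunc poly_def -[k in _ ^+ k]card_ord -prodr_const.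
rewrite bigA_distr_bigA /= coef_sum [RHS]big_mkcond; apply: eq_bigr => m _.
rewrite (eq_bigr (fun i => (f (m i))%:P * 'X^(m i))); last first.
  by move=> i _; rewrite mul_polyC.
rewrite big_split -rmorph_prod /= prodrXr coefCM coefXn eq_sym.
by case: eqP; rewrite ?mulr1 ?mulr0.
Qed.

(** Associativity gives [(f o g) o f = f o (g o f) = f = X o f], and [f] cancels on the right. *)
Lemma left_comp_inverse f g : f 0%N = 0 -> f 1%N = 1 -> g 0%N = 0 ->
  fps_comp g f =1 fps_X -> is_fps_comp_inverse f g.
Proof.
move=> f0 f1 g0 gf; split=> //; apply: (fps_comp_inj f0 f1) => n.
by rewrite fps_compA // (funext gf) fps_comp_X // fps_comp_Xr.
Qed.

End Series.

Local Close Scope ring_scope.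

(** * Counting *)

Lemma blockwise_simple_gt0 n (p : 'S_n) : blockwise_simple p -> 0 < n.
Proof.
elim=> // k s m a {}n {}p k_ge4 _ _ m_gt0 [def_n _].
have lt0k : 0 < k by lia.
by rewrite def_n (bigD1 (Ordinal lt0k)) //= ltn_addr.
Qed.

Definition blockwise_simple_count n : nat :=
  #|[set p : 'S_n | `[< blockwise_simple p >]]|.

Lemma blockwise_simple_count0 : blockwise_simple_count 0 = 0.
Proof.
by apply: eq_card0 => p; rewrite inE; apply/negP=> /asboolP/blockwise_simple_gt0.
Qed.

Lemma blockwise_simple_count1 : blockwise_simple_count 1 = 1.
Proof.
apply/eqP/cards1P; exists 1%g; apply/setP=> p; rewrite !inE.
have -> : p = 1%g by apply/permP=> x; rewrite !ord1.
by rewrite eqxx; apply/asboolP; apply: Blockwise_simple_one.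
Qed.

Definition simple_inflations n k (s : 'S_k) (m : 'I_k -> nat) : {set 'S_n} :=
  [set p | [&& 4 <= k, simple_perm s & `[< exists a : forall i, 'S_(m i),
     (forall i, blockwise_simple (a i)) /\ is_inflation s a p >]]].

Lemma simple_inflationsP n k (s : 'S_k) m (p : 'S_n) :
  reflect [/\ 4 <= k, simple_perm s & exists a : forall i, 'S_(m i),
     (forall i, blockwise_simple (a i)) /\ is_inflation s a p]
   (p \in simple_inflations n s m).
Proof. by rewrite inE; apply: (iffP and3P) => -[? ? /asboolP ?]. Qed.

(** For an admissible shape, inflating is a bijection from the families of block-wise simple blocks
    onto this set. *)
Lemma card_simple_inflations n k (s : 'S_k) (m : 'I_k -> nat) :
  #|simple_inflations n s m| =
  if [&& 4 <= k, simple_perm s & \sum_i m i == n]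
  then \prod_i blockwise_simple_count (m i) else 0.
Proof.
case: and3P => [[k_ge4 simple_s /eqP def_n] | no_infl]; last first.
  apply: eq_card0 => p; apply/negP=> /simple_inflationsP[k_ge4 simple_s [a [_ []]]].
  by move/esym/eqP=> def_n _; apply: no_infl.
have [f infl_f] := choice (fun a : {dffun forall i, 'S_(m i)} =>
  inflation_exists s a (esym def_n)).
have f_inj : injective f.
  move=> a a' eq_f; apply/ffunP=> i.
  by apply: inflation_blocks_unique (infl_f a) _ i; rewrite eq_f.
pose A i := [set p : 'S_(m i) | `[< blockwise_simple p >]].
rewrite /blockwise_simple_count -(cardsXn A) -(card_imset _ f_inj).
congr #|pred_of_set _|; apply/setP=> p.
apply/simple_inflationsP/imsetP=> [[_ _ [a [bws_a infl_a]]] | [a /setXnP aA ->]].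
  exists [ffun i => a i].
    by apply/setXnP=> i; rewrite ffunE inE; apply/asboolP.
  apply: inflation_perm_unique infl_a _.
  have aE : ([ffun i => a i] : {dffun forall i, 'S_(m i)}) = a :> (forall i, 'S_(m i)).
    by apply: functional_extensionality_dep => i; rewrite ffunE.
  by have := infl_f [ffun i => a i]; rewrite aE.
split=> //; exists a; split=> // i.
by have := aA i; rewrite inE => /asboolP.
Qed.

Lemma card_disjoint_bigcup (I T : finType) (F : I -> {set T}) :
  (forall i j x, x \in F i -> x \in F j -> i = j) ->
  #|\bigcup_i F i| = \sum_i #|F i|.
Proof.
move=> F_uniq; rewrite -sum1_card partition_disjoint_bigcup /=.
  by apply: eq_bigr => i _; rewrite sum1_card.
move=> i j neq_ij; apply/pred0P=> x /=; apply/negP=> /andP[xi xj].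
by rewrite (F_uniq i j x) ?eqxx in neq_ij.
Qed.

(** These bounds let [k] and the block sizes range over the finite type ['I_n.+1]. *)
Lemma simple_inflations_order n k (s : 'S_k) m (p : 'S_n) :
  p \in simple_inflations n s m -> k <= n /\ forall i, 0 < m i <= n.
Proof.
case/simple_inflationsP=> _ _ [a [bws_a [def_n _]]].
have m_gt0 i := blockwise_simple_gt0 (bws_a i).
rewrite {}def_n; split=> [|i]; last by rewrite m_gt0 (bigD1 i) ?leq_addr.
by rewrite -{1}[k]card_ord -sum1_card leq_sum.
Qed.

Lemma blockwise_simple_inflation n (p : 'S_n) : n != 1 -> blockwise_simple p ->
  exists k (s : 'S_k) m, p \in simple_inflations n s m.
Proof.
move=> n_neq1 bws_p.
case: bws_p n_neq1 => // k s m a {}n {}p k_ge4 simple_s bws_a infl _.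
by exists k, s, m; apply/simple_inflationsP; split=> //; exists a.
Qed.

(** Sort the permutations by shape [(k, s, m)]: the shapes cover everything but the base case and,
    by uniqueness of the quotient, do not overlap. *)
Lemma blockwise_simple_count_rec n : n != 1 ->
  blockwise_simple_count n = \sum_(k < n.+1 | 4 <= k)
    #|[set s : 'S_k | simple_perm s]| *
    \sum_(m : {ffun 'I_k -> 'I_n.+1} | \sum_i m i == n)
       \prod_i blockwise_simple_count (m i).
Proof.
move=> n_neq1.
pose F k (sm : 'S_k * {ffun 'I_k -> 'I_n.+1}) :=
  simple_inflations n sm.1 (fun i => sm.2 i).
have cover : [set p : 'S_n | `[< blockwise_simple p >]] =
    \bigcup_(k < n.+1) \bigcup_sm F k sm.
  apply/setP=> p; rewrite inE; apply/asboolP/bigcupP=> [bws_p | [k _ /bigcupP[sm _]]].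
    have := blockwise_simple_inflation n_neq1 bws_p.
    case=> k [s [m p_in]]; have [le_kn le_mn] := simple_inflations_order p_in.
    have mE : m = (fun i => [ffun i => inord (m i) : 'I_n.+1] i).
      by apply/funext=> i; rewrite ffunE inordK // ltnS; case/andP: (le_mn i).
    exists (Ordinal (le_kn : k < n.+1)) => //; apply/bigcupP.
    by exists (s, [ffun i => inord (m i)]) => //; rewrite /F /= -mE.
  case/simple_inflationsP=> k_ge4 simple_s [a [bws_a infl]].
  exact: Blockwise_simple_inflation infl.
(* Disjointness is proved first across different [k], then across pairs [(s, m)] for a fixed [k]. *)
rewrite /blockwise_simple_count {}cover card_disjoint_bigcup; last first.
  move=> k k' p /bigcupP[sm _ p_in] /bigcupP[sm' _ p_in'].
  have [_ m_gt0] := simple_inflations_order p_in.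
  have [_ m'_gt0] := simple_inflations_order p_in'.
  case/simple_inflationsP: p_in => k_ge4 simple_s [a [_ infl]].
  case/simple_inflationsP: p_in' => k'_ge4 simple_s' [a' [_ infl']].
  apply/val_inj/(inflation_order_unique _ _ _ infl _ _ _ infl') => //; try exact: ltnW.
    by move=> i; case/andP: (m_gt0 i).
  by move=> i; case/andP: (m'_gt0 i).
rewrite [RHS]big_mkcond; apply: eq_bigr => k _.
rewrite card_disjoint_bigcup; last first.
  move=> [s m] [s' m'] p p_in p_in'.
  have [_ m_gt0] := simple_inflations_order p_in.
  have [_ m'_gt0] := simple_inflations_order p_in'.
  case/simple_inflationsP: p_in => k_ge4 simple_s [a [_ infl]].
  case/simple_inflationsP: p_in' => _ simple_s' [a' [_ infl']].
  have m_gt0' i : 0 < m i by case/andP: (m_gt0 i).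
  have m'_gt0' i : 0 < m' i by case/andP: (m'_gt0 i).
  have [/= -> eq_m] :=
    inflation_shape_unique (ltnW k_ge4) simple_s m_gt0' infl simple_s' m'_gt0' infl'.
  by congr (_, _); apply/ffunP=> i; apply: val_inj; apply: eq_m.
rewrite -(pair_bigA _ (fun s m => #|F k (s, m)|)) /=.
case: ifP => k_ge4; last first.
  by rewrite !big1 // => s _; rewrite big1 // => m _;
    rewrite card_simple_inflations k_ge4.
rewrite -sum1_card big_distrl [RHS]big_mkcond /=; apply: eq_bigr => s _.
rewrite inE mul1n.
case: ifP => simple_s.
  rewrite [RHS]big_mkcond; apply: eq_bigr => m _.
  by rewrite card_simple_inflations k_ge4 simple_s.
by rewrite big1 // => m _; rewrite card_simple_inflations k_ge4 simple_s.
Qed.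

(** * The functional equation and its inversion *)

Local Open Scope ring_scope.

Lemma blockwise_simple_seriesE n :
  blockwise_simple_series n = (blockwise_simple_count n)%:Z.
Proof. by case: n => //; rewrite blockwise_simple_count0. Qed.

(** In the recurrence, the sum over block sizes is the coefficient of [x^n] in [W^k]; the term [X]
    accounts for the permutation of order 1. *)
Lemma blockwise_simple_series_eq n :
  blockwise_simple_series n =
  fps_X n + fps_comp simple_series blockwise_simple_series n.
Proof.
rewrite blockwise_simple_seriesE /fps_X; have [-> | n_neq1] := eqVneq n 1%N.
  (* The sum for coefficient 1 stops at [k = 1], whereas [simple_series] starts at order 4. *)
  rewrite blockwise_simple_count1 /fps_comp big1 ?addr0 // => k _.
  by rewrite /simple_series leqNgt (leq_trans (ltn_ord k)) ?mul0r.
rewrite add0r blockwise_simple_count_rec // /fps_comp -natz natr_sum big_mkcond /=.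
apply: eq_bigr => k _; rewrite /simple_series; case: ifP => _; last by rewrite mul0r.
rewrite natrM natz fps_exp_sum_comp natr_sum; congr (_ * _).
apply: eq_bigr => m _; rewrite natr_prod; apply: eq_bigr => i _.
by rewrite blockwise_simple_seriesE natz.
Qed.

Theorem mainTheorem6 :
  (exists V : fps int, is_fps_comp_inverse blockwise_simple_series V) /\
  (forall V : fps int, is_fps_comp_inverse blockwise_simple_series V ->
     simple_series =1 fps_sub fps_X V).
Proof.
have W0 : blockwise_simple_series 0%N = 0 by [].
have W1 : blockwise_simple_series 1%N = 1.
  by rewrite blockwise_simple_seriesE blockwise_simple_count1.
have left_inv : fps_comp (fps_sub fps_X simple_series) blockwise_simple_series =1 fps_X.
  move=> n; apply: (addIr (fps_comp simple_series blockwise_simple_series n)).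
  rewrite -blockwise_simple_series_eq -(fps_comp_X W0) -big_split /=.
  by apply: eq_bigr => k _; rewrite -mulrDl subrK.
split=> [|V [_ _ _ VW] n].
  by exists (fps_sub fps_X simple_series); apply: left_comp_inverse.
(* Both series are left inverses of [W], and [W] cancels on the right. *)
have eq_V : fps_sub fps_X simple_series =1 V.
  by apply: (fps_comp_inj W0 W1) => k; rewrite left_inv VW.
by rewrite /fps_sub -eq_V /fps_sub subKr.
Qed.
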